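(* Let $\xi_1,\xi_2,\dots$ be independent random variables with $P\{\xi_k=i\}=p_{ik}\ge0$ for $i\in\mathbb N$, $\sum_i p_{ik}=1$, let $\xi=\sum_{n=1}^\infty\frac{(-1)^{n-1}}{\xi_1(\xi_1+\xi_2)\cdots(\xi_1+\dots+\xi_n)}$, let $S_\xi$ be the topological support (minimal closed support) of the distribution of $\xi$, and let $V_k(\xi)=\{i\in\mathbb N: p_{ik}>0\}$. Then: (a) $S_\xi$ is nowhere dense if and only if there are infinitely many $k$ such that $p_{ik}=0$ for some $i\in\mathbb N$. (b) If one of the following holds: (1) each $V_k(\xi)$ has finitely many elements $N_k$ and $\liminf_{k\to\infty}\frac{N_1\cdots N_k}{(k+1)!}=0$; (2) $V_k(\xi)=\{1,2,\dots,m_k\}$ for all $k$ with $\sum_{k}\frac1{m_k}=+\infty$; (3) $V_k(\xi)=V=\mathbb N\setminus\{a_1,a_2,\dots\}$ for all $k$, where $(a_n)$ is a strictly increasing sequence of positive integers with $a_{n+1}-a_n\le d$ for all $n$ and some fixed $d\ge2$; then $S_\xi$ has Lebesgue measure $0$. *)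

(* Defs.v *)
From HB Require Import structures.
From mathcomp Require Export all_boot all_order all_algebra finmap.
From mathcomp Require Export all_classical all_reals all_analysis.
From mathcomp Require Export measurable_realfun.
Export Order.TTheory GRing.Theory Num.Theory.
Export numFieldNormedType.Exports.

Set Implicit Arguments.
Unset Strict Implicit.
Unset Printing Implicit Defensive.

Local Open Scope classical_set_scope.
Local Open Scope ring_scope.

(* A sequence of random variables is indexed from 0, so [xi k] stands for xi_(k+1) and [p i k] for p_(i,k+1); the values i are
   not shifted: they range over {1, 2, ...}. *)

Definition mutually_independent d (T : measurableType d) (R : realType)
    (P : probability T R) (xi : nat -> {RV P >-> R}) : Prop :=
  forall (J : {fset nat}) (B : nat -> set R),
    (forall k, k \in J -> measurable (B k)) ->
    P (\bigcap_(k in [set` J]) (xi k @^-1` B k)) =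
    (\prod_(k <- J) P (xi k @^-1` B k))%E.

Section ostrogradsky.
Context d (T : measurableType d) (R : realType) (P : probability T R).
Variable xi : nat -> {RV P >-> R}.

Definition ostrogradsky_term (w : T) (n : nat) : R :=
  (-1) ^+ n / \prod_(j < n.+1) \sum_(i < j.+1) xi i w.

(* [limn] is a fixed junk value where the series diverges.  When the xi k take
   positive integer values almost surely, the series converges almost surely. *)
Definition ostrogradsky (w : T) : R := limn (series (ostrogradsky_term w)).

Lemma measurable_ostrogradsky : measurable_fun setT ostrogradsky.
Proof.
pose psum w := series (ostrogradsky_term w).
have mpsum n : measurable_fun setT (fun w => (psum w n)%:E).
  apply/measurable_EFinP; apply: measurable_sum => i.
  apply: measurable_funM; first exact: measurable_cst.
  apply: (@measurableT_comp _ _ _ _ _ _ (fun x : R => x^-1)); last first.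
    by apply: measurable_prod => j _; apply: measurable_sum => k.
  have -> : (fun x : R => x^-1) = (fun x : R => if x == 0 then 0 else x^-1).
    by apply/funext => x; case: eqP => // ->; rewrite invr0.
  apply: measurable_fun_if => //=.
  - by apply: (measurable_fun_bool true); rewrite setTI;
      rewrite [X in measurable X](_ : _ = [set 0]) //;
      apply/seteqP; split => x /=; [move/eqP|move=> ->; rewrite eqxx].
  - rewrite setTI [X in measurable_fun X _](_ : _ = ~` [set 0]); last first.
      by apply/seteqP; split => x /=; [move/eqP|move=> /eqP/negbTE].
    apply: open_continuous_measurable_fun.
      by apply: closed_openC; exact: closed_eq.
    by move=> x; rewrite inE => /= /eqP x0; exact: inv_continuous.
pose ls w := limn_esup (fun n => (psum w n)%:E).
pose li w := limn_einf (fun n => (psum w n)%:E).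
have mls : measurable_fun setT ls by exact: measurable_fun_limn_esup.
have mli : measurable_fun setT li.
  apply: measurableT_comp => //; apply: measurable_fun_limn_esup => n.
  exact: measurableT_comp.
pose b w := (ls w \is a fin_num) && (ls w == li w).
have mb : measurable_fun setT b.
  apply: measurable_and; last exact: measurable_fun_eqe.
  by apply: (measurable_fun_bool true); exact: emeasurable_fin_num.
have bP w : b w <-> cvgn (psum w).
  split=> [/andP[lsfin /eqP lsli]|cw].
    have /fine_cvgP[_ h] : (fun n => (psum w n)%:E) @ \oo --> (fine (ls w))%:E.
      rewrite fineK//; apply: (@squeeze_cvge _ _ _ _
          (einfs (fun n => (psum w n)%:E)) _ (esups (fun n => (psum w n)%:E))).
      - apply: nearW => n; apply/andP; split.
          by apply: ereal_inf_lbound; exists n => /=.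
        by apply: ereal_sup_ubound; exists n => /=.
      - by rewrite lsli /li limn_einf_lim; exact: is_cvg_einfs.
      - by rewrite /ls limn_esup_lim; exact: is_cvg_esups.
    by apply/cvg_ex; exists (fine (ls w)).
  have /cvg_limn_einf_sup[liE lsE] :
      (fun n => (psum w n)%:E) @ \oo --> (limn (psum w))%:E.
    by apply/fine_cvgP; split => //; exact: nearW.
  by rewrite /b /ls /li liE lsE eqxx.
rewrite [X in measurable_fun _ X](_ : _ =
    (fun w => if b w then fine (ls w) else point)); last first.
  apply/funext => w; rewrite /ostrogradsky -/(psum w).
  case: ifPn => [/bP cw|nb].
    have /cvg_limn_einf_sup[_ lsE] :
        (fun n => (psum w n)%:E) @ \oo --> (limn (psum w))%:E.
      by apply/fine_cvgP; split => //; exact: nearW.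
    by rewrite /ls lsE.
  by apply: dvgP => cw; move/negP: nb; apply; apply/bP.
by apply: measurable_fun_ifT => //; exact: measurableT_comp.
Qed.

HB.instance Definition _ :=
  isMeasurableFun.Build _ _ _ _ ostrogradsky measurable_ostrogradsky.

End ostrogradsky.

Section support.
Context (R : realType) (mu : set R -> \bar R).

(* For a measure on the line (a second countable space) this intersection is
   itself a set of the family, hence the least closed set of full measure. *)
Definition topological_support : set R :=
  \bigcap_(F in [set F | closed F /\ mu (~` F) = 0%E]) F.

End support.

Definition nowhere_dense (X : topologicalType) (A : set X) : Prop :=
  (closure A)° = set0.

Definition positive_values (R : realType) (p : nat -> nat -> R) (k : nat) :
    set nat :=
  [set i | (0 < i)%N /\ 0 < p i k].

(* Main.v *)
Require Import Defs.
From mathcomp Require Import all_boot all_order all_algebra.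
From mathcomp Require Import all_classical all_reals all_analysis.
From mathcomp Require Import ring lra zify.
Import Order.TTheory GRing.Theory Num.Theory.
Import numFieldNormedType.Exports.

(* Put [pierce q g = 1/(q+g_0) - 1/((q+g_0)(q+g_0+g_1)) + ...], so that
   [pierce q g = (1 - pierce (q+g_0) g') / (q+g_0)] with [g'] the tail of [g],
   and [1/(q+g_0+1) < pierce q g < 1/(q+g_0)]: the first digit is read off the
   value.  The support of [xi] is the closure [S q V] (at [q = 0]) of the values
   whose digits satisfy [g_j \in V_j]; inside the interval of the digit [c] it is
   an affine copy, scaled by [1/(q+c)], of the support of the shifted problem at
   [q+c].  A missing digit leaves a gap in every cylinder of its level, while if
   all the digits are allowed the values are dense, whence (a).  For (b),
   [lambda(S q V) <= \sum_(c in V_0) lambda(S (q+c) V') / (q+c)], and an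
   induction bounds this by [\prod rho_j / (q+1)], [rho_j] being a bound on the
   proportion of a cylinder filled by the digits of [V_j]: [m/(m+1)] in case (2),
   and [1 - 1/(d a_1)] in case (3).  In case (1) one counts cylinders, each of
   length at most [1/(k+1)!]. *)

Set Implicit Arguments.
Unset Strict Implicit.
Unset Printing Implicit Defensive.

Local Open Scope classical_set_scope.
Local Open Scope ring_scope.

Definition dshift (T : Type) (g : nat -> T) : nat -> T := fun n => g n.+1.

(** * Alternating series with shifted base, their digits and cylinders *)

Section pierce.
Context {R : realType}.
Implicit Types (q c n k : nat) (x y : R) (g h : nat -> nat) (V : nat -> set nat).

(** [q] records the sum of the digits already read, so that the tail of such a series is again of
    this form; [q = 0] gives the Ostrogradsky series of [g]. *)
Definition pierce_term q g n : R :=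
  (-1) ^+ n / \prod_(j < n.+1) (q + \sum_(i < j.+1) g i)%:R.

Definition pierce_psum q g : R^nat := series (pierce_term q g).

Definition pierce q g : R := limn (pierce_psum q g).

Lemma pierce_term0 q g : pierce_term q g 0 = (q + g 0)%:R^-1.
Proof. by rewrite /pierce_term big_ord1 big_ord1 expr0 mul1r. Qed.

Lemma pierce_termS q g n :
  pierce_term q g n.+1 = - ((q + g 0)%:R^-1 * pierce_term (q + g 0) (dshift g) n).
Proof.
rewrite /pierce_term big_ord_recl big_ord1 invfM exprS mulN1r !mulNr mulrCA.
congr (- (_ * (_ / _))); apply: eq_bigr => j _.
by rewrite [in LHS]big_ord_recl addnA.
Qed.

Lemma pierce_psum0 q g : pierce_psum q g 0 = 0.
Proof. by rewrite /pierce_psum /series /= big_nil. Qed.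

Lemma pierce_psumS q g n : pierce_psum q g n.+1 =
  (1 - pierce_psum (q + g 0) (dshift g) n) / (q + g 0)%:R.
Proof.
rewrite /pierce_psum /series /= big_nat_recl// pierce_term0 mulrBl mul1r.
congr (_ + _); rewrite mulrC mulr_sumr -sumrN.
by apply: eq_bigr => i _; rewrite pierce_termS.
Qed.

Lemma invn_le m n : (0 < m)%N -> (m <= n)%N -> n%:R^-1 <= m%:R^-1 :> R.
Proof.
by move=> m0 mn; rewrite lef_pV2 ?posrE ?ltr0n ?ler_nat// (leq_trans m0).
Qed.

(** This makes the digit intervals abut: [x |-> (1 - x) / n] maps [[0, 1/(n+1)]] onto
    [[1/(n+1), 1/n]]. *)
Lemma invnB n : (0 < n)%N -> (1 - n.+1%:R^-1) / n%:R = n.+1%:R^-1 :> R.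
Proof.
move=> n0; have n0' : n%:R != 0 :> R by rewrite pnatr_eq0 -lt0n.
by rewrite -natr1; field; rewrite n0' natr1 pnatr_eq0.
Qed.

(** Induction for all [q] at once: the partial sum of the tail lies in [[0, 1]]; it is subtracted
    from 1 and the result divided by [q + g 0 >= q + 1]. *)
Lemma pierce_psum_itv q g n : (forall i, (0 < g i)%N) ->
  0 <= pierce_psum q g n <= q.+1%:R^-1.
Proof.
elim: n q g => [|n IH] q g g0; first by rewrite pierce_psum0 lexx invr_ge0 ler0n.
have qg : (q < q + g 0)%N by rewrite -addn1 leq_add2l.
have /andP[t0 t1] := IH (q + g 0)%N (dshift g) (fun i => g0 i.+1).
have qg0 : 0 < (q + g 0)%:R :> R by rewrite ltr0n (leq_trans _ qg).
rewrite pierce_psumS divr_ge0 ?ler0n ?subr_ge0//=.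
  apply: le_trans (invn_le _ qg) => //.
  by rewrite ler_pdivrMr// mulVf ?gt_eqF// gerBl.
by rewrite (le_trans t1)// invf_le1 ?ltr0n// ler1n.
Qed.

(* Each digit contributes a factor at most 1 and raises the base [q] by at least 1. *)
Lemma pierce_psum_close q g h n a b :
  (forall i, (0 < g i)%N) -> (forall i, (0 < h i)%N) ->
  (forall i, (i < n)%N -> g i = h i) -> (n <= a)%N -> (n <= b)%N ->
  `|pierce_psum q g a - pierce_psum q h b| <= (q + n).+1%:R^-1.
Proof.
elim: n q g h a b => [|n IH] q g h a b g0 h0 gh na nb.
  have /andP[a0 a1] := pierce_psum_itv q a g0.
  have /andP[b0 b1] := pierce_psum_itv q b h0.
  rewrite addn0 ler_norml; apply/andP; split.
    by rewrite lerBrDr (le_trans _ a0)// addrC subr_le0.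
  by rewrite lerBlDr (le_trans a1)// lerDl.
case: a b na nb => [//|a] [//|b] na nb.
have qg : (q < q + g 0)%N by rewrite -addn1 leq_add2l.
rewrite !pierce_psumS -gh// -mulrBl opprD addrACA subrr add0r opprK addrC.
rewrite normrM (ger0_norm (x := _^-1)) ?invr_ge0// distrC.
set u := `|_|; have : u / (q + g 0)%:R <= u.
  by rewrite ler_piMr /u// invf_le1 ?ltr0n ?ler1n (leq_trans _ qg).
move/le_trans; apply.
apply: le_trans (IH _ _ _ _ _ _ _ _ na nb) _ => //.
- by move=> i; exact: g0.
- by move=> i; exact: h0.
- by move=> i ni; exact: gh.
- by apply: invn_le => //; rewrite ltnS addnS ltn_add2r.
Qed.

Lemma invS_lt (e : R) : 0 < e -> exists n, n.+1%:R^-1 < e.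
Proof.
move=> e0; have [n _ /(_ n (leqnn n))] := near_infty_natSinv_lt (PosNum e0).
by exists n.
Qed.

Lemma cvg_pierce q g : (forall i, (0 < g i)%N) ->
  pierce_psum q g @ \oo --> pierce q g.
Proof.
(* [pierce] is itself a [limn], so mere convergence suffices; the Cauchy criterion comes from
   [pierce_psum_close] with [h = g]. *)
move=> g0; suff : cvgn (pierce_psum q g) by [].
apply/cauchy_cvgP/cauchy_ballP => e e0; near_simpl.
have [n ne] := invS_lt e0.
near=> a b; rewrite /ball /=; apply: le_lt_trans ne.
apply: (@le_trans _ _ (q + n).+1%:R^-1); last first.
  by apply: invn_le => //; rewrite ltnS leq_addl.
by apply: pierce_psum_close => //; [near: a|near: b]; exact: nbhs_infty_ge.
Unshelve. all: by end_near. Qed.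

Lemma pierce_close q g h n :
  (forall i, (0 < g i)%N) -> (forall i, (0 < h i)%N) ->
  (forall i, (i < n)%N -> g i = h i) ->
  `|pierce q g - pierce q h| <= n.+1%:R^-1.
Proof.
move=> g0 h0 gh.
have : (fun k => `|pierce_psum q g k - pierce_psum q h k|) @ \oo -->
    `|pierce q g - pierce q h|.
  by apply: cvg_norm; apply: cvgB; exact: cvg_pierce.
move=> cgh; apply: (cvgr_to_le cgh).
near=> k; apply: (@le_trans _ _ (q + n).+1%:R^-1).
  by apply: pierce_psum_close => //; near: k; exact: nbhs_infty_ge.
by apply: invn_le => //; rewrite ltnS leq_addl.
Unshelve. all: by end_near. Qed.

Lemma shift_gt0 g : (forall i, (0 < g i)%N) -> forall i, (0 < dshift g i)%N.
Proof. by move=> g0 i; exact: g0. Qed.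

Lemma pierceE q g : (forall i, (0 < g i)%N) ->
  pierce q g = (1 - pierce (q + g 0) (dshift g)) / (q + g 0)%:R.
Proof.
move=> g0; have := cvg_pierce (q := q) g0; rewrite -cvg_shiftS => cg.
apply: (cvg_unique _ cg) => //=.
under eq_fun do rewrite pierce_psumS.
apply: cvgMr_tmp; apply: cvgB; first exact: cvg_cst.
by apply: cvg_pierce => i; exact: g0.
Qed.

Lemma pierce_le q g : (forall i, (0 < g i)%N) ->
  0 <= pierce q g <= q.+1%:R^-1.
Proof.
move=> g0; have cg := cvg_pierce (q := q) g0.
apply/andP; split.
  by apply: (cvgr_to_ge cg); apply: nearW => n;
    have /andP[] := pierce_psum_itv q n g0.
by apply: (cvgr_to_le cg); apply: nearW => n;
  have /andP[] := pierce_psum_itv q n g0.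
Qed.

(** Strictness comes from the weak bound one level down: the tail is at most
    [1/(q + g 0 + 1) < 1]. *)
Lemma pierce_gt0 q g : (forall i, (0 < g i)%N) -> 0 < pierce q g.
Proof.
move=> g0; rewrite pierceE//.
have /andP[t0 t1] := pierce_le (q + g 0) (shift_gt0 g0).
have c0 : (0 < q + g 0)%N by rewrite (leq_trans (g0 0)) ?leq_addl.
rewrite divr_gt0 ?ltr0n// subr_gt0 (le_lt_trans t1)//.
by rewrite invf_lt1 ?ltr0n// ltr1n.
Qed.

Lemma pierce_ltD q g : (forall i, (0 < g i)%N) ->
  pierce q g < (q + g 0)%:R^-1.
Proof.
move=> g0; have c0 : (0 < q + g 0)%N by rewrite (leq_trans (g0 0)) ?leq_addl.
rewrite pierceE// -[ltRHS]mul1r ltr_pM2r ?invr_gt0 ?ltr0n//.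
by rewrite gtrBl pierce_gt0//; exact: shift_gt0.
Qed.

Lemma pierce_lt q g : (forall i, (0 < g i)%N) -> pierce q g < q.+1%:R^-1.
Proof.
move=> g0; apply: (lt_le_trans (pierce_ltD q g0)); apply: invn_le => //.
by rewrite -addn1 leq_add2l.
Qed.

Lemma pierce_gtD q g : (forall i, (0 < g i)%N) ->
  (q + g 0).+1%:R^-1 < pierce q g.
Proof.
move=> g0; have c0 : (0 < q + g 0)%N by rewrite (leq_trans (g0 0)) ?leq_addl.
rewrite pierceE// -invnB// ltr_pM2r ?invr_gt0 ?ltr0n//.
by rewrite ltrD2l ltrN2 pierce_lt//; exact: shift_gt0.
Qed.

(* The inverse branch of the digit [c]: it maps [pierce q g] to
   [pierce (q + c) (dshift g)] when [g 0 = c]. *)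
Definition pierce_map q c (x : R) : R := 1 - x * (q + c)%:R.

Lemma pierce_mapP q g : (forall i, (0 < g i)%N) ->
  pierce_map q (g 0) (pierce q g) = pierce (q + g 0) (dshift g).
Proof.
move=> g0; have c0 : (0 < q + g 0)%N by rewrite (leq_trans (g0 0)) ?leq_addl.
by rewrite /pierce_map pierceE// divfK ?subKr// pnatr_eq0 -lt0n.
Qed.

Lemma pierce_map_dist q c (x y : R) :
  `|pierce_map q c x - pierce_map q c y| = `|x - y| * (q + c)%:R.
Proof.
rewrite /pierce_map opprD addrACA subrr add0r opprK addrC -mulrBl normrM.
by rewrite (ger0_norm (ler0n _ _)) distrC.
Qed.

Lemma pierce_mapK q c x : (0 < q + c)%N ->
  pierce_map q c ((1 - x) / (q + c)%:R) = x.
Proof. by move=> c0; rewrite /pierce_map divfK ?subKr// pnatr_eq0 -lt0n. Qed.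

(** The open intervals between consecutive inverses of integers are disjoint, so a value determines
    its first digit. *)
Lemma pierce_digit q c c' (x : R) : (0 < c)%N -> (0 < c')%N ->
  (q + c).+1%:R^-1 < x < (q + c)%:R^-1 ->
  (q + c').+1%:R^-1 < x < (q + c')%:R^-1 -> c = c'.
Proof.
wlog : c c' / (c <= c')%N.
  move=> W c0 c0' h h'; have [cc'|/ltnW cc'] := leqP c c'; first exact: W.
  by apply/esym/W.
rewrite leq_eqVlt => /predU1P[//|cc'] c0 c0' /andP[h _] /andP[_ h'].
have := lt_trans h h'; rewrite ltNge invn_le//.
by rewrite -addnS leq_add2l.
Qed.

Definition pierce_set q V : set R :=
  [set pierce q g | g in [set g | forall j, V j (g j)]].

Definition pierce_support q V : set R := closure (pierce_set q V).

Definition positive_digits V := forall j c, V j c -> (0 < c)%N.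

Lemma positive_digits_shift V : positive_digits V -> positive_digits (dshift V).
Proof. by move=> V0 j; exact: V0. Qed.

Lemma pierce_set_sub q V : positive_digits V -> pierce_set q V `<=` `[0, q.+1%:R^-1].
Proof.
move=> V0 _ [g Vg <-] /=; rewrite in_itv/= pierce_le// => i.
exact: V0 (Vg i).
Qed.

Lemma pierce_support_sub q V : positive_digits V ->
  pierce_support q V `<=` `[0, q.+1%:R^-1].
Proof.
move=> V0; rewrite (iffLR (closure_id (`[0, q.+1%:R^-1]%classic : set R))).
  by apply: closure_subset; exact: pierce_set_sub.
exact: interval_closed.
Qed.

Lemma pierce_setS q V x : positive_digits V -> pierce_set q V x ->
  exists2 c, V 0 c & (q + c).+1%:R^-1 < x < (q + c)%:R^-1 /\
    pierce_set (q + c) (dshift V) (pierce_map q c x).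
Proof.
move=> V0 [g Vg <-]; have g0 i : (0 < g i)%N by exact: V0 (Vg i).
exists (g 0) => //; split; first by rewrite pierce_gtD ?pierce_ltD.
by rewrite pierce_mapP//; exists (dshift g) => // j; exact: Vg.
Qed.

Definition dcons c g : nat -> nat := fun n => if n is m.+1 then g m else c.

Lemma pierce_setP q V c x : positive_digits V -> V 0 c ->
  pierce_set (q + c) (dshift V) (pierce_map q c x) -> pierce_set q V x.
Proof.
move=> V0 Vc [g Vg gx]; exists (dcons c g); first by case.
have cp : (0 < q + c)%N by rewrite (leq_trans (V0 _ _ Vc)) ?leq_addl.
have g0 i : (0 < dcons c g i)%N.
  by case: i => [|i]; [exact: V0 Vc | exact: V0 (Vg i)].
rewrite pierceE//= -/(dshift _) gx /pierce_map subKr mulfK//.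
by rewrite pnatr_eq0 -lt0n.
Qed.

Lemma continuous_pierce_map q c : continuous (pierce_map q c).
Proof.
move=> x; apply: cvgB; first exact: cvg_cst.
exact: cvgMr_tmp.
Qed.

(** The interval being open, all the values close to [x] have first digit [c], and the continuous
    [pierce_map] carries approximations of [x] to approximations of its image. An end point would be
    shared by two adjacent cylinders. *)
Lemma pierce_support_localize q V c x : positive_digits V -> (0 < c)%N ->
  (q + c).+1%:R^-1 < x < (q + c)%:R^-1 -> pierce_support q V x ->
  V 0 c /\ pierce_support (q + c) (dshift V) (pierce_map q c x).
Proof.
move=> V0 c0 /[dup] /andP[x1 x2] xc Sx.
have nbx B : nbhs x B -> exists2 y, pierce_set q V y &
    B y /\ (q + c).+1%:R^-1 < y < (q + c)%:R^-1.
  move=> Bx; have nx : nbhs x `](q + c).+1%:R^-1, (q + c)%:R^-1[%classic.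
    by apply: open_nbhs_nbhs; split; [exact: interval_open|rewrite /= in_itv/= xc].
  have [y [Vy [By]]] := Sx _ (filterI Bx nx).
  by rewrite /= in_itv/= => yc; exists y.
have H y : pierce_set q V y -> (q + c).+1%:R^-1 < y < (q + c)%:R^-1 ->
    V 0 c /\ pierce_set (q + c) (dshift V) (pierce_map q c y).
  move=> /(pierce_setS V0)[c' Vc' [yc' Vy]] yc.
  by rewrite (pierce_digit c0 (V0 _ _ Vc') yc yc').
split; first by have [y /H + [_ yc]] := nbx _ (@filterT _ _ _); move=> /(_ yc)[].
move=> B /continuous_pierce_map/nbx[y Vy [By yc]].
by exists (pierce_map q c y); split => //; have [] := H _ Vy yc.
Qed.

Lemma pierce_support_cons q V c x : positive_digits V -> V 0 c ->
  pierce_support (q + c) (dshift V) (pierce_map q c x) -> pierce_support q V x.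
Proof.
move=> V0 Vc Sx; have cp : (0 < q + c)%N.
  by rewrite (leq_trans (V0 _ _ Vc)) ?leq_addl.
pose f (y : R) := (1 - y) / (q + c)%:R.
have fK y : pierce_map q c (f y) = y by exact: pierce_mapK.
have cf : continuous f.
  by move=> y; apply: cvgMr_tmp; apply: cvgB; [exact: cvg_cst|exact: cvg_id].
have fx : f (pierce_map q c x) = x.
  by rewrite /f /pierce_map subKr mulfK// pnatr_eq0 -lt0n.
move=> B; rewrite -{1}fx => /cf/Sx[y [Vy By]].
by exists (f y); split => //; apply: (pierce_setP V0 Vc); rewrite fK.
Qed.

(** Away from 0 only finitely many first digits occur, and a finite union of closed sets is closed.
    At 0 the cylinders of large digits accumulate. *)
Lemma pierce_support_cover q V x :
  positive_digits V -> pierce_support q V x -> x != 0 ->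
  exists2 c, V 0 c & pierce_support (q + c) (dshift V) (pierce_map q c x).
Proof.
move=> V0 Sx xn0; have := pierce_support_sub V0 Sx.
rewrite /= in_itv/= => /andP[x0 _]; have {xn0}x0 : 0 < x.
  by rewrite lt_neqAle eq_sym xn0.
have [N Nx] := invS_lt x0.
pose F c := if pselect (V 0 c) then
  pierce_map q c @^-1` pierce_support (q + c) (dshift V) else set0.
have cF : closed (\bigcup_(c in `I_N.+1) F c).
  apply: closed_bigcup => // c _; rewrite /F.
  case: pselect => [?|?]; last exact: closed0.
  apply: preimage_closed; first by move=> y _; exact: continuous_pierce_map.
  exact: closed_closure.
have : (\bigcup_(c in `I_N.+1) F c) x.
  apply: cF => B Bx.
  have nx : nbhs x `]N.+1%:R^-1, +oo[%classic.
    by apply: open_nbhs_nbhs; split; [exact: interval_open|rewrite /= in_itv/= Nx].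
  have [y [Vy [By]]] := Sx _ (filterI Bx nx).
  rewrite /= in_itv/= andbT => Ny; exists y; split => //.
  have [c Vc [/andP[_ yc] Vy']] := pierce_setS V0 Vy.
  exists c => /=.
    rewrite ltnNge; apply/negP => Nc; have := lt_trans Ny yc.
    by rewrite ltNge invn_le// (leq_trans Nc)// leq_addl.
  by rewrite /F; case: pselect => // _ /=; exact: subset_closure.
by move=> [c _]; rewrite /F; case: pselect => // Vc Sc; exists c.
Qed.

End pierce.

(** * Interior and gaps of the support *)

Section topology.
Context {R : realType}.
Implicit Types (q c n k : nat) (g h : nat -> nat) (V : nat -> set nat) (x y : R).

Lemma pierce_digit_exists q x : 0 < x <= q.+1%:R^-1 ->
  exists2 c, (0 < c)%N & (q + c).+1%:R^-1 <= x <= (q + c)%:R^-1.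
Proof.
move=> /andP[x0 xq]; have ex : exists n, (q + n).+1%:R^-1 <= x.
  have [n /ltW nx] := invS_lt x0; exists n.
  by rewrite (le_trans _ nx)// invn_le// ltnS leq_addl.
(* The digit is the least positive [n] with [1/(q+n+1) <= x]: minimality gives the upper bound when
   [c > 1], the hypothesis on [x] gives it when [c = 1]. *)
have [|c cx cmin] := ex_minnP (P := fun n => (0 < n)%N && ((q + n).+1%:R^-1 <= x)).
  have [n nx] := ex; exists n.+1; rewrite /= (le_trans _ nx)// invn_le//.
  by rewrite !ltnS leq_add2l.
have /andP[c0 cx'] := cx; exists c => //; rewrite cx'/=.
case: c c0 cx cmin cx' => [//|[|c]] _ _ cmin _; first by rewrite addn1.
rewrite leNgt; apply/negP => /ltW; rewrite addnS => h.
by have := cmin c.+1; rewrite h/= ltnn => /(_ isT).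
Qed.

(** Read one digit of [x], approximate its image under [pierce_map] and come back: the inverse
    branch divides the error by [q + c >= 1]. Only an approximation is possible, since the end
    points 0 and [1/(q+1)] are not values of [pierce q]. *)
Lemma pierce_dense q n x : 0 <= x <= q.+1%:R^-1 ->
  exists2 g, forall i, (0 < g i)%N & `|pierce q g - x| <= (q + n).+1%:R^-1.
Proof.
elim: n q x => [|n IH] q x /andP[x0 xq].
  exists (fun=> 1%N) => //; have /andP[p0 p1] := @pierce_le R q (fun=> 1%N) (fun=> isT).
  rewrite addn0 ler_norml.
  by move: (q.+1%:R^-1) xq p1 => Q *; apply/andP; split; lra.
have [{}x0|x0'] := ltP 0 x; last first.
  (* 0 has no first digit; the digit [n.+2] already forces a value below [1/(q+n+2)], the required
     precision. *)
  exists (fun=> n.+2) => //; have -> : x = 0 by apply/le_anti; rewrite x0 {}x0' .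
  rewrite subr0 gtr0_norm ?pierce_gt0//.
  by apply: le_trans (ltW (pierce_ltD _ _)) _ => //; rewrite !addnS.
have [c c0 /andP[c1 c2]] := pierce_digit_exists (introT andP (conj x0 xq)).
have qc0 : (0 < q + c)%N by rewrite (leq_trans c0) ?leq_addl.
have qcR : 0 < (q + c)%:R :> R by rewrite ltr0n.
have [|g g0 gx] := IH (q + c)%N (pierce_map q c x).
  rewrite /pierce_map subr_ge0 -ler_pdivlMr// mul1r c2/=.
  by rewrite lerBlDr -lerBlDl -ler_pdivrMr// invnB.
have g0' i : (0 < dcons c g i)%N by case: i.
exists (dcons c g) => //.
move: gx; rewrite -[pierce _ g](pierce_mapP q g0')/= pierce_map_dist => gx.
apply: le_trans (le_trans gx _); first by rewrite ler_peMr// ler1n.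
by rewrite invn_le// ltnS addnS ltn_add2r -addn1 leq_add2l.
Qed.

Lemma pierce_support_full q V : (forall j c, (0 < c)%N -> V j c) ->
  `[0, q.+1%:R^-1]%classic `<=` (pierce_support q V : set R).
Proof.
move=> fV x; rewrite /= in_itv/= => x01 B /nbhs_ballP[e /= e0 xB].
have [n ne] := invS_lt e0.
have [g g0 gx] := pierce_dense n x01.
exists (pierce q g); split; first by exists g => // j; exact: fV.
apply: xB; rewrite /ball/= distrC; apply: le_lt_trans ne.
by rewrite (le_trans gx)// invn_le// ltnS leq_addl.
Qed.

(** After [k] arbitrary allowed digits all levels are full and the support is an interval; its
    interior is pulled back through the continuous maps [pierce_map]. *)
Lemma pierce_support_interior V k q : positive_digits V -> (forall j, V j !=set0) ->
  (forall j c, (k <= j)%N -> (0 < c)%N -> V j c) ->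
  (pierce_support q V : set R)° !=set0.
Proof.
elim: k V q => [|k IH] V q V0 Vn fV.
  exists (q.+1%:R^-1 / 2); rewrite /interior/=.
  have q0 : 0 < q.+1%:R^-1 :> R by rewrite invr_gt0 ltr0n.
  apply: (@filterS _ _ _ (`]0, q.+1%:R^-1[%classic)).
    move=> x x01; apply: pierce_support_full => [j c|]; first exact: fV.
    exact: subset_itv_oo_cc x01.
  apply: open_nbhs_nbhs; split; first exact: interval_open.
  by rewrite /= in_itv/= divr_gt0//= ltr_pdivrMr// ltr_pMr// ltr1n.
have [c Vc] := Vn 0.
have [|//|//|y Sy] := IH (dshift V) (q + c)%N.
- exact: positive_digits_shift.
- by move=> j; exact: Vn.
- by move=> j c' kj c'0; exact: fV.
have cp : (0 < q + c)%N by rewrite (leq_trans (V0 _ _ Vc)) ?leq_addl.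
exists ((1 - y) / (q + c)%:R).
apply: (@filterS _ _ _ (pierce_map q c @^-1` pierce_support (q + c) (dshift V))).
  by move=> x; exact: pierce_support_cons.
by apply: continuous_pierce_map; rewrite pierce_mapK.
Qed.

(** Inside the cylinder of the first [n] digits of [g], the open interval of the forbidden digit [i]
    misses the support; [y] is the preimage of its midpoint. *)
Lemma pierce_support_gap V q n i g : positive_digits V -> (0 < i)%N -> ~ V n i ->
  (forall j, V j (g j)) ->
  exists2 y : R, ~ pierce_support q V y & `|pierce q g - y| <= n.+1%:R^-1.
Proof.
move=> V0 i0 Vi Vg.
(* The strict bounds on [y] place its image under an inverse branch in the open interval of a digit,
   as [pierce_support_localize] requires. *)
suff : exists2 y : R, 0 < y < q.+1%:R^-1 /\ ~ pierce_support q V y &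
    `|pierce q g - y| <= (q + n).+1%:R^-1.
  move=> [y [_ Sy] yn]; exists y => //.
  by rewrite (le_trans yn)// invn_le// ltnS leq_addl.
elim: n q V g V0 Vi Vg => [|n IH] q V g V0 Vi Vg.
  have qi : (0 < q + i)%N by rewrite (leq_trans i0) ?leq_addl.
  have ab : (q + i).+1%:R^-1 < (q + i)%:R^-1 :> R.
    by rewrite ltf_pV2 ?posrE ?ltr0n// ltr_nat.
  have bq : (q + i)%:R^-1 <= q.+1%:R^-1 :> R.
    by apply: invn_le => //; rewrite -addn1 leq_add2l.
  have a0 : 0 < (q + i).+1%:R^-1 :> R by rewrite invr_gt0 ltr0n.
  have g0 j : (0 < g j)%N by exact: V0 (Vg j).
  have /andP[p0 p1] := @pierce_le R q g g0.
  pose y : R := ((q + i).+1%:R^-1 + (q + i)%:R^-1) / 2.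
  have yab : (q + i).+1%:R^-1 < y < (q + i)%:R^-1 by rewrite /y !midf_lt.
  exists y.
    split; first by case/andP: yab => y1 y2; rewrite (lt_trans a0)//= (lt_le_trans y2).
    by move=> /(pierce_support_localize V0 i0 yab)[].
  case/andP: yab => y1 y2; rewrite addn0 ler_norml; apply/andP; split.
    rewrite lerBrDr (le_trans _ p0)// addrC subr_le0; exact: ltW (lt_le_trans y2 bq).
  by rewrite lerBlDr (le_trans p1)// lerDl ltW// (lt_trans a0).
have [] := IH (q + g 0)%N (dshift V) (dshift g).
- exact: positive_digits_shift.
- exact: Vi.
- by move=> j; exact: Vg.
move=> y [/andP[y0 y1] Sy] gy; set c := g 0 in y1 Sy gy.
have c0 : (0 < c)%N by exact: V0 (Vg 0).
have qc : (0 < q + c)%N by rewrite (leq_trans c0) ?leq_addl.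
have qcR : 0 < (q + c)%:R :> R by rewrite ltr0n.
have yc : (q + c).+1%:R^-1 < (1 - y) / (q + c)%:R < (q + c)%:R^-1.
  rewrite -invnB// -[X in _ < _ < X]mul1r !ltr_pM2r ?invr_gt0//.
  by rewrite ltrD2l ltrN2 y1 gtrBl.
exists ((1 - y) / (q + c)%:R).
  split.
    rewrite (lt_trans _ (andP yc).1) ?invr_gt0 ?ltr0n//=.
    by rewrite (lt_le_trans (andP yc).2)// invn_le// -addn1 leq_add2l.
  by move=> /(pierce_support_localize V0 c0 yc)[_]; rewrite pierce_mapK.
move: gy; rewrite -pierce_mapP; last by move=> j; exact: V0 (Vg j).
rewrite -/c -[X in `|_ - X|](pierce_mapK (q := q) (c := c))// pierce_map_dist.
move=> gy; apply: le_trans (le_trans gy _); first by rewrite ler_peMr// ler1n.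
by rewrite invn_le// ltnS addnS ltn_add2r -addn1 leq_add2l.
Qed.

Lemma infinite_natP (X : set nat) :
  infinite_set X <-> forall m, exists2 k, (m <= k)%N & X k.
Proof.
split=> [infX m|Xm].
  apply: contrapT => nX; apply: infX; apply: (sub_finite_set _ (finite_II m)).
  move=> k Xk /=; rewrite ltnNge; apply/negP => mk; apply: nX; by exists k.
move=> /finite_fsetP[F XF].
have [k Fk] := Xm (\max_(i <- F) i).+1.
rewrite XF/= => kF; have := leq_bigmax_seq (F := id) _ kF isT.
by rewrite leqNgt Fk.
Qed.

(** If the levels from some [m] on are full, there is interior. Otherwise an interior point yields a
    ball in the support around some [pierce 0 g], and a missing digit at a deep enough level puts a
    point outside the support into that ball. *)
Lemma pierce_support_nowhere_dense V : positive_digits V -> (forall j, V j !=set0) ->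
  nowhere_dense (pierce_support 0 V : set R) <->
  infinite_set [set k : nat | exists2 i : nat, (0 < i)%N & ~ V k i].
Proof.
move=> V0 Vn; rewrite /nowhere_dense.
rewrite -(iffLR (closure_id _) (@closed_closure _ (pierce_set 0 V))).
rewrite infinite_natP; split=> [S0 m|inf].
  apply: contrapT => nV.
  have [|x] := pierce_support_interior (k := m) 0 V0 Vn; last by rewrite S0.
  move=> j c mj c0; apply: contrapT => Vjc; apply: nV.
  by exists j => //; exists c.
rewrite -subset0 => x Sx.
have [_ [[g Vg <-] gS]] : exists y, pierce_set 0 V y /\ (pierce_support 0 V)° y.
  apply: (interior_subset Sx); apply: open_nbhs_nbhs.
  by split => //; exact: open_interior.
have /nbhs_ballP[e /= e0 eS] := gS.
have [n ne] := invS_lt e0.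
have [k nk [i i0 Vki]] := inf n.
have [y Sy gy] := pierce_support_gap 0 V0 i0 Vki Vg.
apply: Sy; apply: eS; rewrite /ball/=; apply: le_lt_trans ne.
by rewrite (le_trans gy)// invn_le.
Qed.

End topology.

(** * Measure bounds obtained by descending through the levels *)

Section measure.
Context {R : realType}.
Implicit Types (q c n k : nat) (g h : nat -> nat) (V : nat -> set nat) (x y : R).

(** By uniqueness of Lebesgue measure: [a] times its pushforward agrees with it on the half-open
    intervals. *)
Lemma lebesgue_measure_affine_preimage (a b : R) (X : set R) :
  0 < a -> measurable X ->
  lebesgue_measure ((fun x : R => b - x * a) @^-1` X) =
    (a^-1%:E * lebesgue_measure X)%E.
Proof.
move=> a0 mX; pose f : R -> measurableTypeR R := fun x => b - x * a.
have mf : measurable_fun [set: R] f.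
  by apply: measurable_funB; [exact: measurable_cst|exact: measurable_funM].
have H : lebesgue_measure X =
    mscale (NngNum (ltW a0)) (pushforward lebesgue_measure f) X.
  move=> ?; apply: lebesgue_measure_unique => //= _ [[u v]] _ <-.
  rewrite /mscale /pushforward /=.
  rewrite [X in lebesgue_measure X = _](_ : _ = `]u, v]%classic)//.
  (* The map is decreasing, so the closed end of the interval changes side. *)
  rewrite [X in (_ * lebesgue_measure X)%E](_ : _ =
      `[(b - v) / a, (b - u) / a[%classic); last first.
    apply/seteqP; split => x /=; rewrite !in_itv/= ler_pdivrMr// ltr_pdivlMr// /f;
    by move=> /andP[? ?]; apply/andP; split; lra.
  rewrite !lebesgue_measure_itv/= !lte_fin ltr_pM2r ?invr_gt0// ltrD2l ltrN2.
  case: ifPn => uv; last by rewrite mule0.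
  rewrite -!EFinD -EFinM; congr EFin; field; exact: lt0r_neq0.
by rewrite H// /mscale /pushforward muleA -EFinM /= mulVf ?lt0r_neq0// mul1e.
Qed.


Lemma measurable_pierce_support q V : measurable (pierce_support q V : set R).
Proof. by apply: closed_measurable; exact: closed_closure. Qed.

Lemma pierce_support_measure_le0 q V : positive_digits V ->
  (lebesgue_measure (pierce_support q V : set R) <= (q.+1%:R^-1)%:E)%E.
Proof.
move=> V0; have -> : (q.+1%:R^-1)%:E =
    lebesgue_measure (`[0, q.+1%:R^-1]%classic : set R).
  by rewrite lebesgue_measure_itv/= lte_fin invr_gt0 ltr0n/= oppr0 adde0.
apply: le_measure; rewrite ?inE.
- exact: measurable_pierce_support.
- exact: measurable_itv.
- exact: pierce_support_sub.
Qed.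

(** Countable subadditivity over the first digit, each cylinder being a copy scaled by [1/(q+c)]. *)
Lemma pierce_support_measure_step q V (B : nat -> R) (r : R) : positive_digits V ->
  (forall c, V 0 c -> (lebesgue_measure
     (pierce_support (q + c) (dshift V) : set R) <= (B c)%:E)%E) ->
  (forall n, \sum_(0 <= c < n | c \in V 0) B c / (q + c)%:R <= r) ->
  (lebesgue_measure (pierce_support q V : set R) <= r%:E)%E.
Proof.
move=> V0 SB Br.
have qc0 c : V 0 c -> 0 < (q + c)%:R :> R.
  by move=> Vc; rewrite ltr0n (leq_trans (V0 _ _ Vc)) ?leq_addl.
(* The default [[set 0]] is null and covers the point 0, which [pierce_support_cover] leaves out; it
   is reached at the index 0, never a digit. *)
pose F c : set R := if c \in V 0
  then pierce_map q c @^-1` pierce_support (q + c) (dshift V) else [set 0].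
have mF c : measurable (F c).
  rewrite /F; case: ifPn => _; last exact: measurable_set1.
  apply: closed_measurable; apply: preimage_closed; last exact: closed_closure.
  by move=> x _; exact: continuous_pierce_map.
have SF : pierce_support q V `<=` \bigcup_c F c.
  move=> x Sx; have [->|x0] := eqVneq x 0.
    exists 0 => //; rewrite /F ifF//; apply/negP; rewrite in_setE => /V0.
    by rewrite ltnn.
  have [c Vc Sc] := pierce_support_cover V0 Sx x0.
  by exists c => //; rewrite /F ifT ?in_setE.
have mS := measurable_pierce_support q V.
apply: (le_trans (measure_sigma_subadditive (@lebesgue_measure R) mF mS SF)).
apply: lime_le; first by apply: is_cvg_nneseries.
apply: nearW => n; have := Br n; rewrite -lee_fin -sumEFin; apply: le_trans.
rewrite [leRHS]big_mkcond/=; apply: lee_sum => c _; rewrite /F.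
case: ifPn => [|_]; last by rewrite lebesgue_measure_set1.
rewrite in_setE => Vc; rewrite /pierce_map lebesgue_measure_affine_preimage//.
- by rewrite mulrC EFinM lee_pmul2l ?lte_fin ?invr_gt0 ?qc0//; exact: SB.
- exact: qc0.
- exact: measurable_pierce_support.
Qed.

(** The summand is the length of the cylinder of [c], so [rho j] bounds the share of [[0, 1/(q+1)]]
    kept at level [j]. It must do so for every base, because the base depends on the preceding
    digits. *)
Lemma pierce_support_measure_ratio q V (rho : nat -> R) n : positive_digits V ->
  (forall j, 0 <= rho j) ->
  (forall j q n, \sum_(0 <= c < n | c \in V j) ((q + c).+1%:R^-1 / (q + c)%:R)
     <= rho j / q.+1%:R) ->
  (lebesgue_measure (pierce_support q V : set R) <=
    ((\prod_(j < n) rho j) / q.+1%:R)%:E)%E.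
Proof.
elim: n q V rho => [|n IH] q V rho V0 rho0 H.
  by rewrite big_ord0 div1r pierce_support_measure_le0.
apply: (pierce_support_measure_step (B := fun c =>
   (\prod_(j < n) rho j.+1) / (q + c).+1%:R)) => // [c Vc|m].
  apply: (IH _ _ (dshift rho)) => //.
  - exact: positive_digits_shift.
  - by move=> j; exact: rho0.
  - by move=> j; exact: H.
under eq_bigr do rewrite -mulrA.
rewrite -mulr_sumr big_ord_recl mulrAC mulrC.
have P0 : 0 <= \prod_(j < n) rho j.+1 by apply: prodr_ge0 => ? _; exact: rho0.
exact: ler_wpM2r P0 _ _ (H 0 q m).
Qed.

Lemma sum_cond_card_le (A : set nat) (N m : nat) (w : nat -> R) (K : R) :
  (A #= `I_N)%card -> 0 <= K -> (forall c, A c -> w c <= K) ->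
  \sum_(0 <= c < m | c \in A) w c <= N%:R * K.
Proof.
move=> AN K0 wK; have finA : finite_set A by apply/finite_setP; exists N.
apply: (@le_trans _ _ (\sum_(0 <= c < m | c \in A) K)).
  by apply: ler_sum => c; rewrite in_setE; exact: wK.
rewrite -big_filter big_const_seq iter_addr_0 count_predT -[leLHS]mulr_natl.
rewrite ler_wpM2r// ler_nat -(card_fset_set AN).
apply: uniq_leq_size; first by rewrite filter_uniq ?iota_uniq.
by move=> c; rewrite mem_filter in_fset_set// => /andP[].
Qed.

(** There are [\prod N j] cylinders of depth [n]; they are longest when all the digits are 1, which
    gives the denominator. *)
Lemma pierce_support_measure_card q V (N : nat -> nat) n : positive_digits V ->
  (forall k, (V k #= `I_(N k))%card) ->
  (lebesgue_measure (pierce_support q V : set R) <=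
    ((\prod_(j < n) N j)%:R / (\prod_(i < n.+1) (q + i.+1))%:R)%:E)%E.
Proof.
elim: n q V N => [|n IH] q V N V0 VN.
  by rewrite big_ord0 big_ord1 div1r addn1 pierce_support_measure_le0.
pose D q := (\prod_(i < n.+1) (q + i.+1))%:R : R.
have D0 m : 0 < D m.
  by rewrite ltr0n prodn_gt0// => i; rewrite addnS.
apply: (pierce_support_measure_step (B := fun c =>
   (\prod_(j < n) N j.+1)%:R / D (q + c)%N)) => // [c Vc|m].
  apply: (IH _ _ (dshift N)); [exact: positive_digits_shift | by move=> k; exact: VN].
(* [K] is the summand at the least conceivable digit [c = 1], every factor being nonincreasing in
   [c]. *)
apply: le_trans (sum_cond_card_le
  (K := (\prod_(j < n) N j.+1)%:R / D q.+1 / q.+1%:R) _ (VN 0) _ _) _.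
- by rewrite !divr_ge0 ?ler0n// ltW.
- move=> c /V0 c0; have qc : (q.+1 <= q + c)%N by rewrite -addn1 leq_add2l.
  apply: ler_pM; rewrite ?invr_ge0 ?ler0n//.
    by rewrite divr_ge0 ?ler0n ?(ltW (D0 _)).
    rewrite ler_wpM2l ?ler0n// lef_pV2 ?posrE// ler_nat; apply: leq_prod => i _.
    by rewrite leq_add2r.
  exact: invn_le.
rewrite le_eqVlt; apply/orP; left; apply/eqP.
rewrite big_ord_recl [in RHS]big_ord_recl !natrM addn1 invfM /D.
rewrite [X in _ = _ * (_ * X^-1)](_ : _ = (\prod_(i < n.+1) (q.+1 + i.+1))%:R).
  have E (a b d e : R) : a * (b / d / e) = a * b * (e^-1 * d^-1).
    by rewrite [e^-1 * _]mulrC !mulrA.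
  exact: E.
by congr (_%:R); apply: eq_bigr => i _; rewrite lift0 addnS addSn.
Qed.

End measure.

(** * Null supports in the three cases *)

Section null_supports.
Context {R : realType}.
Implicit Types (q c n k : nat) (g h : nat -> nat) (V : nat -> set nat) (x y : R).

Let wt q c : R := (q + c).+1%:R^-1 / (q + c)%:R.

Let wt_ge0 q c : 0 <= wt q c.
Proof. by rewrite divr_ge0 ?invr_ge0 ?ler0n. Qed.

Lemma inv_mul_succn n : (0 < n)%N ->
  n.+1%:R^-1 / n%:R = n%:R^-1 - n.+1%:R^-1 :> R.
Proof.
move=> n0; have n0' : n%:R != 0 :> R by rewrite pnatr_eq0 -lt0n.
by rewrite -natr1; field; rewrite n0' natr1 pnatr_eq0.
Qed.

Lemma sum_inv_mul_succn_le q (P : pred nat) u v n : (0 < u <= v)%N ->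
  (forall c, (c < n)%N -> P c -> (u <= c < v)%N) ->
  \sum_(0 <= c < n | P c) ((q + c).+1%:R^-1 / (q + c)%:R) <=
    (q + u)%:R^-1 - (q + v)%:R^-1 :> R.
Proof.
move=> /andP[u0 uv] Puv; have qu a : (u <= a)%N -> (0 < q + a)%N.
  by move=> ua; rewrite (leq_trans u0)// (leq_trans ua)// leq_addl.
(* The weights telescope; clamping [n] to [[u, v]] gives a bound that moves only while the sum can
   grow. *)
suff : \sum_(0 <= c < n | P c) wt q c <=
    (q + u)%:R^-1 - (q + maxn u (minn n v))%:R^-1.
  move/le_trans; apply; rewrite lerD2l lerN2 invn_le ?qu ?leq_maxl//.
  by rewrite leq_add2l geq_max uv geq_minr.
elim: n Puv => [|n IH] Puv.
  by rewrite big_nil min0n maxn0 subrr.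
rewrite big_mkcond big_nat_recr//= -big_mkcond/=.
have {}IH := IH (fun c cn => Puv c (ltnW cn)).
case: ifPn => [Pn|_]; last first.
  rewrite addr0 (le_trans IH)// lerD2l lerN2 invn_le ?qu ?leq_maxl//.
  by rewrite leq_add2l; lia.
have /andP[un nv] := Puv n (ltnSn n) Pn.
have -> : maxn u (minn n.+1 v) = n.+1 by lia.
have un' : maxn u (minn n v) = n by lia.
rewrite {}un' in IH; rewrite /wt inv_mul_succn ?qu// addnS.
by rewrite addrA lerD2r -lerBrDr.
Qed.

(** With [x = q] and [y = m]: the digits [1..m] fill the share [m/(q+m+1) <= m/(m+1)], written so
    that its inverse is [1 + 1/m]. *)
Lemma inv_sub_inv_le_ratio x y : 0 <= x -> 0 < y ->
  (x + 1)^-1 - (x + y + 1)^-1 <= (1 + y^-1)^-1 / (x + 1).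
Proof.
move=> x0 y0; have x1 : 0 < x + 1 by lra.
have xy1 : 0 < x + y + 1 by lra.
have y1 : 0 < y + 1 by lra.
have -> : (x + 1)^-1 - (x + y + 1)^-1 = y / (x + y + 1) / (x + 1).
  by field; rewrite !gt_eqF.
have -> : (1 + y^-1)^-1 = y / (y + 1) by field; rewrite !gt_eqF.
rewrite ler_pM2r ?invr_gt0// ler_pM2l// lef_pV2 ?posrE//; lra.
Qed.

(** Among [y] consecutive cylinders the first is the longest, so deleting it removes at least the
    share [1/y >= 1/z]. *)
Lemma inv_sub_inv_gap_le x y z : 0 < x -> 1 <= y -> y <= z ->
  (x + 1)^-1 - (x + y)^-1 <= (1 - z^-1) * (x^-1 - (x + y)^-1).
Proof.
move=> x0 y1 yz; have x1 : 0 < x + 1 by lra.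
have xy : 0 < x + y by lra.
have z0 : 0 < z by lra.
have -> : (x + 1)^-1 - (x + y)^-1 = (y - 1) / (x + 1) / (x + y).
  by field; rewrite !gt_eqF.
have -> : (1 - z^-1) * (x^-1 - (x + y)^-1) = (y - y / z) / x / (x + y).
  by field; rewrite !gt_eqF.
rewrite ler_pM2r ?invr_gt0//; apply: ler_pM.
- by rewrite subr_ge0.
- by rewrite invr_ge0 ltW.
- by rewrite lerD2l lerN2 ler_pdivrMr// mul1r.
- by rewrite lef_pV2 ?posrE// lerDl.
Qed.

Lemma ereal_eq0_le (x : \bar R) : (0 <= x)%E ->
  (forall e : R, 0 < e -> (x <= e%:E)%E) -> x = 0%E.
Proof.
move=> x0 xe; apply/le_anti; rewrite x0 andbT; apply/lee_addgt0Pr => e e0.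
by rewrite add0e xe.
Qed.

(** The measure is below every term of the sequence, hence below the infimum of each tail and below
    their limit. *)
Lemma pierce_support_null_card V (N : nat -> nat) : positive_digits V ->
  (forall k, (V k #= `I_(N k))%card) ->
  limn_einf (fun k : nat =>
    ((\prod_(j < k) N j)%:R / (k.+1)`!%:R)%:E : \bar R) = 0%E ->
  lebesgue_measure (pierce_support 0 V : set R) = 0%E.
Proof.
move=> V0 VN; rewrite limn_einf_lim => lim0.
apply/le_anti; rewrite measure_ge0 andbT -lim0.
apply: lime_ge; first exact: is_cvg_einfs.
apply: nearW => n; apply/ereal_infP => _ [k _ <-].
apply: le_trans (pierce_support_measure_card 0 k V0 VN) _.
by rewrite fact_prod big_add1 big_mkord.
Qed.

(** Weierstrass' inequality, which turns divergence of the series into divergence of the product. *)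
Lemma prodr_onep_ge (b : nat -> R) n : (forall j, 0 <= b j) ->
  1 + \sum_(0 <= j < n) b j <= \prod_(j < n) (1 + b j).
Proof.
move=> b0; elim: n => [|n IH]; first by rewrite big_nil big_ord0 addr0.
rewrite big_nat_recr//= big_ord_recr/= addrA.
apply: (@le_trans _ _ ((1 + \sum_(0 <= j < n) b j) * (1 + b n))).
  by rewrite mulrDr mulr1 lerD2l ler_peMl// lerDl sumr_ge0.
by rewrite ler_wpM2r// addr_ge0.
Qed.

Lemma pierce_support_null_initial V (m : nat -> nat) : positive_digits V ->
  (forall k, V k = [set i : nat | (1 <= i <= m k)%N]) ->
  (\sum_(0 <= k <oo) ((m k)%:R^-1)%:E = +oo :> \bar R)%E ->
  lebesgue_measure (pierce_support 0 V : set R) = 0%E.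
Proof.
move=> V0 VE moo; apply: ereal_eq0_le; first exact: measure_ge0.
move=> e e0; pose b j : R := (m j)%:R^-1.
have b0 j : 0 <= b j by rewrite invr_ge0 ler0n.
have [n en] : exists n, e^-1 <= \sum_(0 <= j < n) b j.
  apply: contrapT => H; suff : (+oo <= (e^-1)%:E)%E by rewrite leye_eq.
  rewrite -moo; apply: lime_le; first by apply: is_cvg_nneseries.
  apply: nearW => n; rewrite sumEFin lee_fin leNgt; apply/negP => en.
  by apply: H; exists n; exact: ltW.
apply: le_trans
  (pierce_support_measure_ratio (rho := fun j => (1 + b j)^-1) 0 n V0 _ _) _.
- by move=> j; rewrite invr_ge0 addr_ge0.
- move=> j q k; apply: le_trans (@sum_inv_mul_succn_le q _ 1 (m j).+1 _ _ _) _ => //.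
    by move=> c _; rewrite in_setE VE.
  (* If [m j = 0], the left side vanishes and [b j] is 0 by the convention on the inverse of 0. *)
  rewrite /b addn1 addnS; have [->|mj0] := posnP (m j).
    by rewrite addn0 subrr mulr_ge0 ?invr_ge0 ?ler0n// invr0 addr0.
  have := @inv_sub_inv_le_ratio q%:R (m j)%:R (ler0n _ _).
  by rewrite ltr0n -natrD !natr1; exact.
rewrite lee_fin invr1 mulr1 prodfV -[leRHS]invrK lef_pV2 ?posrE ?invr_gt0//; last first.
  by apply: prodr_gt0 => j _; rewrite ltr_pwDl.
by rewrite (le_trans en)// (le_trans _ (prodr_onep_ge n b0))// lerDr.
Qed.

Lemma pierce_support_null_gaps V (a : nat -> nat) (D : nat) : positive_digits V ->
  (2 <= D)%N -> (forall n, (0 < a n)%N) -> (forall n, (a n < a n.+1)%N) ->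
  (forall n, (a n.+1 - a n <= D)%N) ->
  (forall k, V k = [set i : nat | (0 < i)%N] `\` range a) ->
  lebesgue_measure (pierce_support 0 V : set R) = 0%E.
Proof.
move=> V0 D2 a0 aS aD VE; apply: ereal_eq0_le; first exact: measure_ge0.
move=> e e0; pose rho : R := 1 - (D * a 0)%:R^-1.
have Da0 : (1 < D * a 0)%N by rewrite (leq_trans D2)// leq_pmulr.
have rho0 : 0 <= rho by rewrite subr_ge0 invf_le1 ?ler1n ?ltr0n (ltn_trans _ Da0).
have rho1 : rho < 1 by rewrite gtrBl invr_gt0 ltr0n (ltn_trans _ Da0).
have amono : {homo a : i j / (i < j)%N} by apply: homo_ltn => //; exact: ltn_trans.
have age n : (n <= a n)%N.
  by elim: n => // n IH; rewrite (leq_ltn_trans IH).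
have H j q n : \sum_(0 <= c < n | c \in V j) wt q c <= rho / q.+1%:R.
  have qa i : 0 < (q + a i)%:R :> R by rewrite ltr0n (leq_trans (a0 i)) ?leq_addl.
  (* The digits below [a 0] are all kept; each block from [a M] up to [a M.+1] loses at least the
     share [1/D], and the block lengths telescope. *)
  have pot M : \sum_(0 <= c < a M | c \in V j) wt q c <=
     (q + 1)%:R^-1 - (q + a 0)%:R^-1 +
     (1 - D%:R^-1) * ((q + a 0)%:R^-1 - (q + a M)%:R^-1).
    elim: M => [|M IH].
      rewrite subrr mulr0 addr0; apply: sum_inv_mul_succn_le => [|c ca].
        by rewrite a0.
      by rewrite in_setE VE => -[/= c0 _]; rewrite c0.
    rewrite (big_cat_nat (n := a M)) ?(ltnW (aS M))//=.
    have -> : (q + a 0)%:R^-1 - (q + a M.+1)%:R^-1 = 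
        ((q + a 0)%:R^-1 - (q + a M)%:R^-1) +
        ((q + a M)%:R^-1 - (q + a M.+1)%:R^-1) :> R.
      by rewrite addrA subrK.
    rewrite mulrDr addrA lerD//.
    rewrite (big_nat_widenl _ 0)//.
    apply: le_trans (@sum_inv_mul_succn_le q _ (a M).+1 (a M.+1) _ _ _) _.
    - by rewrite ltnS leq0n aS.
    - move=> c caM /andP[]; rewrite in_setE VE => -[/= _ ca] aMc.
      rewrite caM andbT ltn_neqAle aMc andbT; apply/eqP => caM'.
      by apply: ca; exists M.
    - have := @inv_sub_inv_gap_le (q + a M)%:R (a M.+1 - a M)%:R D%:R (qa M).
    rewrite ler1n subn_gt0 aS ler_nat aD natr1 -addnS -natrD.
    rewrite (_ : (q + a M + _)%N = (q + a M.+1)%N) => [/(_ isT isT)//|].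
    by have := aS M; lia.
  have : \sum_(0 <= c < n | c \in V j) wt q c <= \sum_(0 <= c < a n | c \in V j) wt q c.
    by rewrite [leRHS](big_cat_nat (n := n))//= lerDl sumr_ge0.
  move/le_trans; apply; apply: le_trans (pot n) _.
  have D0 : (0 < D)%N by rewrite (leq_trans _ D2).
  have D1 : 0 <= 1 - D%:R^-1 :> R by rewrite subr_ge0 invf_le1 ?ltr0n ?ler1n.
  have Y0 : 0 <= (1 - D%:R^-1) * (q + a n)%:R^-1 :> R by rewrite mulr_ge0 ?invr_ge0.
  (* Since [q + a 0 <= a 0 * (q + 1)], the loss beyond [a 0] is at least the share [1/(D * a 0)] of
     the whole interval, uniformly in [q]. *)
  have : (D * a 0)%:R^-1 / q.+1%:R <= D%:R^-1 / (q + a 0)%:R :> R.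
    rewrite -!invfM -!natrM; apply: invn_le.
      by rewrite muln_gt0 D0 addn_gt0 a0 orbT.
    by rewrite -mulnA leq_pmul2l//; have := a0 0; nia.
  rewrite /rho addn1; move: Y0; move: (q.+1%:R^-1) (D%:R^-1).
  move: ((q + a 0)%:R^-1) ((D * a 0)%:R^-1) ((q + a n)%:R^-1).
  by move=> A B C Q E Y0 h; lra.
have [n rn] : exists n, rho ^+ n < e.
  have : \forall n \near \oo, rho ^+ n < e.
    by apply: (cvgr_lt (0 : R)) => //; apply: cvg_expr; rewrite ger0_norm.
  by move=> [n _ /(_ n (leqnn n))]; exists n.
apply: le_trans (pierce_support_measure_ratio (rho := fun=> rho) 0 n V0 _ _) _ => //.
by rewrite lee_fin invr1 mulr1 prodr_const card_ord ltW.
Qed.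

End null_supports.

(** * The support of the random series *)

Section support.
Context (R : realType) (d : measure_display) (T : measurableType d)
  (P : probability T R) (xi : nat -> {RV P >-> R}) (p : nat -> nat -> R).
Context (indep : mutually_independent xi)
  (p_ge0 : forall i k : nat, (0 < i)%N -> 0 <= p i k)
  (p_sum1 : forall k : nat, (\sum_(1 <= i <oo) (p i k)%:E = 1)%E)
  (xi_law : forall i k : nat, (0 < i)%N ->
    P (xi k @^-1` [set i%:R]) = (p i k)%:E).

Let V : nat -> set nat := positive_values p.

Lemma ostrogradsky_pierce (w : T) (g : nat -> nat) :
  (forall i, xi i w = (g i)%:R) -> ostrogradsky xi w = pierce 0 g.
Proof.
move=> xg; rewrite /ostrogradsky /pierce /pierce_psum.
congr (limn (series _)); apply/funext => n.
rewrite /ostrogradsky_term /pierce_term; congr (_ / _).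
apply: eq_bigr => j _; rewrite add0n natr_sum.
by apply: eq_bigr => i _; rewrite xg.
Qed.

Lemma positive_digits_values : positive_digits V.
Proof. by move=> j c []. Qed.

Lemma positive_values_neq0 k : V k !=set0.
Proof.
apply/set0P/eqP => V0; have := p_sum1 k.
rewrite eseries0 => [/eqP|i i1 _]; first by rewrite eq_sym onee_eq0.
congr EFin; apply/le_anti; rewrite p_ge0// andbT leNgt; apply/negP => pi.
by have : V k i by []; rewrite V0.
Qed.

Let measurable_digit k (i : nat) : measurable (xi k @^-1` [set i%:R]).
Proof. exact: measurable_funPTI. Qed.

Lemma digit_negligible k :
  P.-negligible [set w | ~ exists2 i, V k i & xi k w = i%:R].
Proof.
pose E (i : nat) := xi k @^-1` [set i%:R : R].
pose U := \bigcup_(i in [set i : nat | (0 < i)%N]) E i.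
have mU : measurable U by apply: bigcup_measurable => i _; exact: measurable_digit.
have PU : P U = 1%E.
  rewrite /U measure_bigcup//; first last.
  - move=> i j _ _ [w []]; rewrite /E/= => -> /eqP.
    by rewrite eqr_nat => /eqP.
  - by move=> i _; exact: measurable_digit.
  rewrite -(p_sum1 k) [RHS]eseries_cond/=.
  rewrite [RHS](_ : _ = (\sum_(i <oo | i \in [set i : nat | (0 < i)%N]) (p i k)%:E)%E).
    by apply: eq_eseriesr => i; rewrite in_setE => i0; exact: xi_law.
  by apply: eq_eseriesl => i; apply/idP/idP; rewrite in_setE.
have nU : P.-negligible (~` U).
  apply/negligibleP; first exact: measurableC.
  have := probability_setC P mU; rewrite PU subee//; exact.
pose Z i := if p i k == 0 then E i else set0.
(* The index is shifted because [xi_law] speaks only of positive values. *)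
have nZ : P.-negligible (\bigcup_i Z i.+1).
  apply: negligible_bigcup => i; rewrite /Z; case: eqP => [pi0|_]; last first.
    exact: negligible_set0.
  apply/negligibleP; first exact: measurable_digit.
  by have := xi_law k (ltn0Sn i); rewrite pi0.
apply: negligibleS (negligibleU nU nZ) => w /= Vw.
have [[i /= i0 Ei]|nUw] := pselect (U w); last by left.
right; exists i.-1 => //; rewrite prednK// /Z ifT//; apply/eqP/le_anti.
rewrite p_ge0// andbT leNgt; apply/negP => pi; apply: Vw.
by exists i.
Qed.

Lemma digits_negligible : P.-negligible [set w | ~ exists g : nat -> nat,
  (forall k, V k (g k)) /\ forall k, xi k w = (g k)%:R].
Proof.
apply: negligibleS (negligible_bigcup digit_negligible) => w /= nw.
apply: contrapT => H; apply: nw.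
have ex k : exists i, V k i /\ xi k w = i%:R.
  apply: contrapT => nk; apply: H; exists k => //= -[i Vi xki].
  by apply: nk; exists i.
exists (fun k => projT1 (cid (ex k))).
by split=> k; have [] := projT2 (cid (ex k)).
Qed.

(** By independence the probability is a finite product of positive numbers [p (g k) k]. *)
Lemma cylinder_not_negligible (g : nat -> nat) n : (forall k, V k (g k)) ->
  ~ P.-negligible [set w | forall k, (k < n)%N -> xi k w = (g k)%:R].
Proof.
move=> Vg; pose J := [fset k | k in iota 0 n]%fset.
have -> : [set w | forall k, (k < n)%N -> xi k w = (g k)%:R] =
    \bigcap_(k in [set` J]) (xi k @^-1` [set (g k)%:R]).
  apply/seteqP; split => w /= H k; last first.
    by move=> kn; apply: (H k); rewrite /= !inE mem_iota.
  by rewrite /= !inE mem_iota => /H.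
have mJ : measurable (\bigcap_(k in [set` J]) (xi k @^-1` [set (g k)%:R])).
  by apply: fin_bigcap_measurable => // k _; exact: measurable_digit.
move/negligibleP => /(_ mJ).
have : P (\bigcap_(k in [set` J]) (xi k @^-1` [set (g k)%:R])) =
    (\prod_(k <- J) (p (g k) k)%:E)%E.
  rewrite (@indep J (fun k => [set (g k)%:R])); last first.
    by move=> k _; exact: measurable_set1.
  by apply: eq_bigr => k _; rewrite xi_law// (positive_digits_values (Vg k)).
move=> PE P0; have := etrans (esym PE) P0.
rewrite prodEFin => -[] /eqP; apply/negP; apply: lt0r_neq0.
by apply: prodr_gt0 => k _; have [] := Vg k.
Qed.

(** Almost surely the digits are allowed, so [pierce_support 0 V] is closed of full measure.
    Conversely, if a closed [F] missed some [pierce 0 g], a whole cylinder around [g], which is not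
    negligible, would take almost all its values outside [F]. *)
Lemma ostrogradsky_support :
  topological_support (distribution P (ostrogradsky xi)) = pierce_support 0 V.
Proof.
apply/seteqP; split => [x Sx|x Sx F [clF PF]].
  apply: Sx; split; first exact: closed_closure.
  rewrite /distribution /pushforward.
  have mS : measurable (~` (pierce_support 0 V : set R)).
    by apply: measurableC; exact: measurable_pierce_support.
  apply/negligibleP.
    by rewrite -[X in measurable X]setTI; exact: measurable_ostrogradsky.
  apply: negligibleS digits_negligible => w /= nSw [g [Vg xg]]; apply: nSw.
  rewrite (ostrogradsky_pierce xg); apply: subset_closure.
  by exists g.
suff SF : pierce_set 0 V `<=` F.
  by rewrite (iffLR (closure_id F) clF); exact: closure_subset Sx.
move=> _ [g Vg <-]; apply: contrapT => Fg.
have mF : measurable (~` F) by apply: measurableC; exact: closed_measurable.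
have nF : P.-negligible (ostrogradsky xi @^-1` (~` F)).
  apply/negligibleP => //.
  by rewrite -[X in measurable X]setTI; exact: measurable_ostrogradsky.
have /nbhs_ballP[e /= e0 eF] : nbhs (pierce 0 g) (~` F).
  by apply: open_nbhs_nbhs; split => //; exact: closed_openC.
have [n ne] := invS_lt e0.
apply: (@cylinder_not_negligible g n Vg).
apply: negligibleS (negligibleU nF digits_negligible) => w /= gw.
have [[h [Vh xh]]|nw] := pselect (exists h : nat -> nat,
  (forall k, V k (h k)) /\ forall k, xi k w = (h k)%:R); last by right.
left; rewrite (ostrogradsky_pierce xh); apply: eF; rewrite /ball/=.
apply: le_lt_trans ne; apply: pierce_close => [i|i|i ilt].
- exact: positive_digits_values (Vg i).
- exact: positive_digits_values (Vh i).
- by have := gw i ilt; rewrite xh => /eqP; rewrite eqr_nat => /eqP.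
Qed.

End support.

Theorem theorem11 (R : realType) (d : measure_display) (T : measurableType d)
    (P : probability T R) (xi : nat -> {RV P >-> R}) (p : nat -> nat -> R)
    (indep : mutually_independent xi)
    (p_ge0 : forall i k : nat, (0 < i)%N -> 0 <= p i k)
    (p_sum1 : forall k : nat, (\sum_(1 <= i <oo) (p i k)%:E = 1)%E)
    (xi_law : forall i k : nat, (0 < i)%N ->
       P (xi k @^-1` [set i%:R]) = (p i k)%:E) :
  let S : set R := topological_support (distribution P (ostrogradsky xi)) in
  let V : nat -> set nat := positive_values p in
  (* (a) *)
  (nowhere_dense S <->
     infinite_set [set k : nat | exists2 i : nat, (0 < i)%N & p i k = 0])
  /\
  (* (b) *)
  ((exists N : nat -> nat,
      (forall k, (V k #= `I_(N k))%card) /\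
      limn_einf (fun k : nat =>
        ((\prod_(j < k) N j)%:R / (k.+1)`!%:R)%:E : \bar R) = 0%E)
   \/
   (exists m : nat -> nat,
      (forall k, V k = [set i : nat | (1 <= i <= m k)%N]) /\
      (\sum_(0 <= k <oo) ((m k)%:R^-1)%:E = +oo :> \bar R)%E)
   \/
   (exists (a : nat -> nat) (D : nat),
      [/\ (2 <= D)%N,
          (forall n, (0 < a n)%N),
          (forall n, (a n < a n.+1)%N),
          (forall n, (a n.+1 - a n <= D)%N) &
          forall k, V k = [set i : nat | (0 < i)%N] `\` range a])
   -> lebesgue_measure S = 0%E).
Proof.
move=> S V; have -> : S = pierce_support 0 V by exact: ostrogradsky_support.
have V0 : positive_digits V by exact: positive_digits_values.
split; last first.
  case=> [[N [VN N0]]|[[m [Vm m_oo]]|[a [D [D2 a0 aS aD Va]]]]].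
  - exact: pierce_support_null_card VN N0.
  - exact: pierce_support_null_initial Vm m_oo.
  - exact: pierce_support_null_gaps D2 a0 aS aD Va.
rewrite pierce_support_nowhere_dense//; last exact: positive_values_neq0.
(* As the weights are nonnegative, a positive digit is forbidden exactly when its weight is zero. *)
have -> // : [set k | exists2 i, (0 < i)%N & p i k = 0] =
  [set k | exists2 i, (0 < i)%N & ~ V k i].
apply/seteqP; split => k [i i0 pi]; exists i => //; first by case=> _; rewrite pi ltxx.
apply/le_anti; rewrite p_ge0// andbT leNgt; apply/negP => pi0.
by apply: pi.
Qed.
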